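(* Let $(\mathcal{S},\mathcal{A},p,d_{\varnothing},\gamma)$ be a finite discounted MDP with $\gamma\in[0,1)$, let $T\ge 1$, let $(r^t)_{t=1}^T$ be a sequence of reward functions $r^t:\mathcal{S}\times\mathcal{A}\times\mathcal{S}\to[-U,U]$, and let $(\pi^t)_{t=1}^T$ be the sequence of stationary policies produced by CFR on this sequence, so that the cumulative advantages satisfy $$\sum_{t=1}^T \rho_s(a,\pi^t;r^t)\le C^T\qquad\text{for all } s\in\mathcal{S},\ a\in\mathcal{A}.$$ Then, for every stationary policy $\pi$, $$\sum_{t=1}^T \bigl(v_{\varnothing}(\pi;r^t)-v_{\varnothing}(\pi^t;r^t)\bigr)\le \frac{C^T}{1-\gamma}.$$
   Context: MDP. $\mathcal{S}$ is a finite set of states, $\mathcal{A}$ a finite set of actions, $p(\cdot\mid s,a)$ a probability distribution on $\mathcal{S}$ for each $(s,a)$ (Markovian transitions), $d_{\varnothing}$ an initial state distribution on $\mathcal{S}$, $\gamma\in[0,1)$ a discount factor. The transition probabilities and initial distribution are fixed and known; only reward functions vary. A reward function is a map $r:\mathcal{S}\times\mathcal{A}\times\mathcal{S}\to[-U,U]$, $U\in\mathbb{R}$. A stationary policy $\pi$ assigns to each state $s$ a probability distribution $\pi(\cdot\mid s)$ on $\mathcal{A}$. Returns (normalized by $1-\gamma$). With $A_i\sim\pi(\cdot\mid S_{i-1})$ and $S_i\sim p(\cdot\mid S_{i-1},A_i)$ for $i\ge1$: $v_{\varnothing}(\pi;r)=(1-\gamma)\,\mathbb{E}\bigl[\sum_{i=0}^\infty\gamma^i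 r(S_i,A_{i+1},S_{i+1})\bigr]$ with $S_0\sim d_{\varnothing}$; $q_s(a,\pi;r)=(1-\gamma)\,\mathbb{E}\bigl[\sum_{i=0}^\infty\gamma^i r(S_i,A_{i+1},S_{i+1})\mid S_0=s,A_1=a\bigr]$ (take $a$ first, follow $\pi$ afterwards); $v_s(\pi;r)=\mathbb{E}_{A\sim\pi(\cdot\mid s)}[q_s(A,\pi;r)]$; advantage $\rho_s(a,\pi;r)=q_s(a,\pi;r)-v_s(\pi;r)$. CFR. Given reward functions $r^1,r^2,\dots$ revealed one at a time, CFR produces stationary policies $\pi^1,\pi^2,\dots$ by running a no-regret learner at each state $s$, which generates $\pi^t(\cdot\mid s)$ and then learns from $q_s(\cdot,\pi^t;r^t)$. Its defining property is that for every $s\in\mathcal{S}$, $a\in\mathcal{A}$, $\sum_{t=1}^T\rho_s(a,\pi^t;r^t)\le C^T$, where $C^T\in o(T)$ is a bound depending on the learner used. *)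

(* Defs.v *)
From HB Require Import structures.
From mathcomp Require Import all_boot all_order all_algebra.
From mathcomp Require Import all_classical all_reals all_analysis.

Set Implicit Arguments.
Unset Strict Implicit.
Unset Printing Implicit Defensive.

Import Order.TTheory GRing.Theory Num.Theory.
Import numFieldNormedType.Exports.

Local Open Scope classical_set_scope.
Local Open Scope ring_scope.

Record dist (R : realType) (X : finType) := Dist {
  pmf :> X -> R ;
  pmf_ge0 : forall x, 0 <= pmf x ;
  pmf_sum1 : \sum_x pmf x = 1 }.

Section dist_constructions.
Context (R : realType).

Definition point_mass_pmf (X : finType) (x : X) : X -> R :=
  fun y => (y == x)%:R.

Lemma point_mass_ge0 (X : finType) (x : X) : forall y, 0 <= point_mass_pmf x y.
Proof. by move=> y; rewrite /point_mass_pmf ler0n. Qed.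

Lemma point_mass_sum1 (X : finType) (x : X) : \sum_y point_mass_pmf x y = 1.
Proof.
rewrite (bigD1 x) //= /point_mass_pmf eqxx big1 ?addr0 // => y /negPf ->.
by [].
Qed.

Definition point_mass (X : finType) (x : X) : dist R X :=
  Dist (point_mass_ge0 x) (point_mass_sum1 x).

Context (X Y : finType) (d : dist R X) (k : X -> dist R Y).

Definition joint_pmf : X * Y -> R := fun z => d z.1 * k z.1 z.2.

Lemma joint_ge0 : forall z, 0 <= joint_pmf z.
Proof. by move=> z; rewrite /joint_pmf mulr_ge0 ?pmf_ge0. Qed.

Lemma joint_sum1 : \sum_z joint_pmf z = 1.
Proof.
rewrite -(pair_bigA _ (fun x y => d x * k x y)) /= -(pmf_sum1 d).
by apply: eq_bigr => x _; rewrite -big_distrr /= pmf_sum1 mulr1.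
Qed.

(* The law of (x, y) with x drawn from d and then y drawn from k x. *)
Definition joint : dist R (X * Y)%type := Dist joint_ge0 joint_sum1.

End dist_constructions.

(* Existence of a Markov chain with a given initial distribution and
   transition kernel on a finite set: one uniform variable u on [0, 1[ is
   converted into the first symbol by inversion of the distribution function,
   and the position of u inside the selected subinterval, rescaled to [0, 1[,
   generates the rest of the chain. *)
Section markov_chain_existence.
Context (R : realType) (X : finType).
Implicit Types (d : dist R X) (K : X -> dist R X) (w : nat -> X).

Fixpoint pick_at (d : X -> R) (x0 : X) (s : seq X) (u : R) : X :=
  if s is x :: s' then
    if u < d x then x else pick_at d x0 s' (u - d x)
  else x0.

Fixpoint mass_before (d : X -> R) (s : seq X) (x : X) : R :=
  if s is y :: s' then
    if y == x then 0 else d y + mass_before d s' x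
  else 0.

Lemma mass_before_ge0 d s x : 0 <= mass_before d s x.
Proof.
elim: s => //= y s IHs; case: ifP => // _.
by rewrite addr_ge0 // pmf_ge0.
Qed.

Lemma mass_before_le d s x : x \in s ->
  mass_before d s x + d x <= \sum_(y <- s) d y.
Proof.
elim: s => //= y s IHs; rewrite inE big_cons eq_sym.
case: eqVneq => [->|_] /=.
  by move=> _; rewrite add0r lerDl sumr_ge0 // => z _; rewrite pmf_ge0.
by move=> /IHs; rewrite -addrA lerD2l.
Qed.

Lemma mem_pick_at d x0 s (u : R) : u < \sum_(y <- s) d y -> 0 <= u ->
  pick_at d x0 s u \in s.
Proof.
elim: s u => [|y s IHs] u /=.
  by rewrite big_nil => u_lt /(le_lt_trans)/(_ u_lt); rewrite ltxx.
rewrite big_cons inE => u_lt u_ge0.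
case: ltP => [_|dy_le]; first by rewrite eqxx.
by rewrite IHs ?orbT // ?ltrBlDl // subr_ge0.
Qed.

Lemma pick_atP d x0 s (u : R) x : uniq s -> x \in s ->
  u < \sum_(y <- s) d y -> 0 <= u ->
  (pick_at d x0 s u == x) =
  (mass_before d s x <= u < mass_before d s x + d x).
Proof.
elim: s u => [//|y s IHs] u /= /andP[y_notin uniq_s].
rewrite inE eq_sym big_cons; case: eqVneq => [<-|y_neq] /=.
  move=> _ u_lt u_ge0; rewrite u_ge0 add0r /=.
  case: ltP => [_|dy_le]; first by rewrite eqxx.
  apply/negbTE/eqP => E; have := @mem_pick_at d x0 s (u - d y).
  by rewrite E (negbTE y_notin) ltrBlDl subr_ge0 => /(_ u_lt dy_le).
move=> x_in u_lt u_ge0; case: ltP => [u_lty|dy_le].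
  rewrite (negbTE y_neq); apply/esym/negbTE.
  rewrite negb_and -ltNge; apply/orP; left.
  by rewrite (lt_le_trans u_lty) // lerDl mass_before_ge0.
rewrite IHs // ?subr_ge0 // ?ltrBlDl //.
by rewrite lerBrDl addrA.
Qed.

Lemma dist_inhabited d : exists x : X, true.
Proof.
apply: contrapT => noX; have := oner_neq0 R.
rewrite -(pmf_sum1 d) big1 ?eqxx // => x _.
by exfalso; apply: noX; exists x.
Qed.

Definition quantile d (u : R) : X :=
  pick_at d (xchoose (dist_inhabited d)) (enum X) u.

Definition chain_step d (u : R) : R :=
  (u - mass_before d (enum X) (quantile d u)) / d (quantile d u).

Fixpoint chain K d (u : R) (n : nat) : X :=
  if n is n'.+1 then chain K (K (quantile d u)) (chain_step d u) n'
  else quantile d u.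

Definition chain_prob K d w (n : nat) : R :=
  d (w 0%N) * \prod_(i < n) K (w i) (w i.+1).

Lemma chain_prob_ge0 K d w n : 0 <= chain_prob K d w n.
Proof. by rewrite mulr_ge0 ?pmf_ge0 // prodr_ge0 // => i _; exact: pmf_ge0. Qed.

Lemma chain_probS K d w n : chain_prob K d w n.+1 =
  d (w 0%N) * chain_prob K (K (w 0%N)) (fun i => w i.+1) n.
Proof. by rewrite /chain_prob big_ord_recl. Qed.

Lemma quantileP d (u : R) x : 0 <= u -> u < 1 ->
  (quantile d u == x) = (mass_before d (enum X) x <= u
                         < mass_before d (enum X) x + d x).
Proof.
move=> u_ge0 u_lt1; apply: pick_atP => //; rewrite ?enum_uniq ?mem_enum //.
by rewrite big_enum /= pmf_sum1.
Qed.

Lemma mass_before_le1 d x : mass_before d (enum X) x + d x <= 1.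
Proof.
rewrite -(pmf_sum1 d) -[leRHS]big_enum /=.
by apply: mass_before_le; rewrite mem_enum.
Qed.

Lemma chain_interval K n d w : exists a : R,
  [/\ 0 <= a, a + chain_prob K d w n <= 1 &
   forall u : R, 0 <= u -> u < 1 ->
     (forall i, (i <= n)%N -> chain K d u i = w i) <->
     a <= u < a + chain_prob K d w n].
Proof.
elim: n d w => [|n IHn] d w.
  exists (mass_before d (enum X) (w 0%N)).
  rewrite /chain_prob big_ord0 mulr1.
  split; [exact: mass_before_ge0|exact: mass_before_le1|].
  move=> u u_ge0 u_lt1; rewrite -quantileP //; split.
    by move=> /(_ 0%N isT) /= ->.
  by move=> /eqP E [|//] _ /=.
have [a [a_ge0 a_le1 aP]] := IHn (K (w 0%N)) (fun i => w i.+1).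
set c := mass_before d (enum X) (w 0%N).
set p := chain_prob K (K (w 0%N)) (fun i => w i.+1) n in a_le1 aP *.
have c_ge0 : 0 <= c := mass_before_ge0 _ _ _.
have d_ge0 := pmf_ge0 d (w 0%N).
have c_le1 : c + d (w 0%N) <= 1 := mass_before_le1 _ _.
have p_ge0 : 0 <= p := chain_prob_ge0 _ _ _ _.
have dap_le : d (w 0%N) * (a + p) <= d (w 0%N) by rewrite ler_piMr.
exists (c + d (w 0%N) * a); rewrite chain_probS -/p; split.
- by rewrite addr_ge0 // mulr_ge0.
- by rewrite -addrA -mulrDr (le_trans _ c_le1) // lerD2l.
move=> u u_ge0 u_lt1.
have [d_gt0|d_le0] := ltP 0 (d (w 0%N)); last first.
  have d0 : d (w 0%N) = 0 by apply/eqP; rewrite eq_le d_le0 d_ge0.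
  rewrite d0 !mul0r !addr0; split.
    move=> /(_ 0%N isT) /= /eqP; rewrite quantileP // d0 addr0 => h.
    by move: h => /andP[h1 /(le_lt_trans h1)]; rewrite ltxx.
  by move=> /andP[h1 /(le_lt_trans h1)]; rewrite ltxx.
have rescale : (c <= u < c + d (w 0%N)) ->
    0 <= (u - c) / d (w 0%N) < 1.
  move=> /andP[h1 h2]; rewrite divr_ge0 ?subr_ge0 //=.
  by rewrite ltr_pdivrMr // mul1r ltrBlDl.
have rescaleE : (a <= (u - c) / d (w 0%N) < a + p) =
    (c + d (w 0%N) * a <= u < c + d (w 0%N) * a + d (w 0%N) * p).
  rewrite ler_pdivlMr // ltr_pdivrMr // lerBrDl ltrBlDl.
  by rewrite -addrA -mulrDr [a * _]mulrC [(a + p) * _]mulrC.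
split.
  move=> chain_w; have /= /eqP := chain_w 0%N isT.
  rewrite quantileP // -/c => in_c.
  have q_w : quantile d u = w 0%N by apply/eqP; rewrite quantileP.
  have /andP[v_ge0 v_lt1] := rescale in_c.
  rewrite -rescaleE; apply/(aP _ v_ge0 v_lt1) => i i_le.
  by have /= := chain_w i.+1 i_le; rewrite /chain_step q_w -/c.
move=> in_cap; have in_c : c <= u < c + d (w 0%N).
  move: in_cap => /andP[h1 h2]; apply/andP; split.
    by rewrite (le_trans _ h1) // lerDl mulr_ge0.
  by rewrite (lt_le_trans h2) // -addrA -mulrDr lerD2l.
have q_w : quantile d u = w 0%N by apply/eqP; rewrite quantileP.
have /andP[v_ge0 v_lt1] := rescale in_c.
move=> [|i] i_le /=; first exact: q_w.
rewrite /chain_step q_w -/c.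
by apply: (aP _ v_ge0 v_lt1).2 => //; rewrite rescaleE.
Qed.

Definition unit_law : set (measurableTypeR R) -> \bar R :=
  mrestr (@lebesgue_measure R) (measurable_itv `[0%R, 1%R[).

HB.instance Definition _ := Measure.on unit_law.

Lemma unit_law_setT : unit_law setT = 1%E.
Proof.
rewrite /unit_law /mrestr setTI lebesgue_measure_itv /= lte_fin ltr01.
by rewrite oppr0 adde0.
Qed.

HB.instance Definition _ :=
  Measure_isProbability.Build _ _ _ unit_law unit_law_setT.

(* Outside [0, 1[, a null set, the chain is frozen at 0 so that its
   level sets are visibly measurable. *)
Definition chain_process K d (n : nat) (u : measurableTypeR R) : X :=
  chain K d (if (0 <= u) && (u < 1) then u else 0) n.

Lemma chain_processP K d w n :
  let E := [set u | forall i, (i <= n)%N -> chain_process K d i u = w i] in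
  measurable E /\ unit_law E = (chain_prob K d w n)%:E.
Proof.
move=> E; have [a [a_ge0 a_le1 aP]] := chain_interval K n d w.
set p := chain_prob K d w n in a_le1 aP *.
have p_ge0 : 0 <= p := chain_prob_ge0 _ _ _ _.
have EI : E `&` [set` `[0%R, 1%R[] = [set` `[a, a + p[].
  apply/seteqP; split => u /=.
    rewrite !in_itv /= => -[Eu /andP[u_ge0 u_lt1]].
    apply/(aP u u_ge0 u_lt1) => i i_le.
    by have := Eu i i_le; rewrite /chain_process u_ge0 u_lt1.
  rewrite !in_itv /= => /andP[au uap].
  have u_ge0 := le_trans a_ge0 au; have u_lt1 := lt_le_trans uap a_le1.
  split; last by rewrite u_ge0.
  move=> i i_le; rewrite /chain_process u_ge0 u_lt1 /=.
  by apply: (aP u u_ge0 u_lt1).2 => //; rewrite au.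
split; last first.
  rewrite /unit_law /mrestr EI lebesgue_measure_itv /= lte_fin ltrDl.
  case: ltP => [_|p_le0]; first by rewrite -EFinB addrAC subrr add0r.
  by congr (_%:E); apply/eqP; rewrite eq_le p_le0 p_ge0.
have meas0 : measurable ([set` `[0%R, 1%R[] : set (measurableTypeR R)).
  exact: measurable_itv.
rewrite -(setIT E) -(setUv [set` `[0%R, 1%R[]) setIUr.
apply: measurableU; first by rewrite EI; exact: measurable_itv.
have [E0|notE0] := pselect (E 0).
  rewrite (_ : E `&` _ = ~` [set` `[0%R, 1%R[]); first exact: measurableC.
  apply/seteqP; split => u /=; first by case.
  move=> u_notin; split => //; move: u_notin.
  rewrite in_itv /= => /negP/negbTE u_out.
  move=> i i_le; have := E0 i i_le.
  by rewrite /chain_process u_out lexx ltr01.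
rewrite (_ : E `&` _ = set0); first exact: measurable0.
apply/seteqP; split => u //= -[Eu].
rewrite in_itv /= => /negP/negbTE u_out; apply: notE0 => i i_le.
by have := Eu i i_le; rewrite /chain_process u_out lexx ltr01.
Qed.

End markov_chain_existence.

Record mdp (R : realType) (S A : finType) := Mdp {
  trans : S -> A -> dist R S ;
  init : dist R S ;
  gamma : R ;
  gamma_ge0 : 0 <= gamma ;
  gamma_lt1 : gamma < 1 }.

Definition policy (R : realType) (S A : finType) := S -> dist R A.

Definition reward (R : realType) (S A : finType) := S -> A -> S -> R.

(* A random trajectory S_0, A_1, S_1, A_2, ... on some probability space, in
   which (S_0, A_1) has law mu, S_i ~ p(. | S_{i-1}, A_i) for i >= 1 and
   A_i ~ pi(. | S_{i-1}) for i >= 2.  Mind the shift of the action index: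
   [act i] is A_{i+1}, the action taken in state [state i] = S_i. *)
Record trajectory (R : realType) (S A : finType) (M : mdp R S A)
    (pi : policy R S A) (mu : dist R (S * A)%type) := Trajectory {
  tdisp : measure_display ;
  omega : measurableType tdisp ;
  prob : probability omega R ;
  state : nat -> omega -> S ;
  act : nat -> omega -> A ;
  trajectory_measurable : forall n (s : nat -> S) (a : nat -> A),
    measurable [set o | forall i, (i <= n)%N ->
                          state i o = s i /\ act i o = a i] ;
  trajectory_law : forall n (s : nat -> S) (a : nat -> A),
    prob [set o | forall i, (i <= n)%N -> state i o = s i /\ act i o = a i] =
    (mu (s 0%N, a 0%N) *
     \prod_(i < n) (trans M (s i) (a i) (s i.+1) * pi (s i.+1) (a i.+1)))%:E }.

Arguments omega {R S A M pi mu} t.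
Arguments prob {R S A M pi mu} t.
Arguments state {R S A M pi mu} t _ _.
Arguments act {R S A M pi mu} t _ _.

Section mdp_values.
Context (R : realType) (S A : finType) (M : mdp R S A).

Lemma trajectory_exists (pi : policy R S A) (mu : dist R (S * A)%type) :
  inhabited (trajectory M pi mu).
Proof.
pose K (z : S * A) := joint (trans M z.1 z.2) pi.
pose xi := chain_process K mu.
have xiE n (s : nat -> S) (a : nat -> A) :
    [set u | forall i, (i <= n)%N -> (xi i u).1 = s i /\ (xi i u).2 = a i] =
    [set u | forall i, (i <= n)%N -> xi i u = (s i, a i)].
  apply/seteqP; split => u /= h i /h; first by case: (xi i u) => ? ? /= [-> ->].
  by move=> ->.
constructor.
apply: (@Trajectory _ _ _ _ _ _ _ (measurableTypeR R) (@unit_law R)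
  (fun i u => (xi i u).1) (fun i u => (xi i u).2)) => n s a; rewrite xiE.
  by have [] := chain_processP K mu (fun i => (s i, a i)) n.
by have [_ lawE] := chain_processP K mu (fun i => (s i, a i)) n; exact: lawE.
Qed.

(* Which trajectory is used is immaterial: expected returns only depend on
   the law, which [trajectory_law] determines. *)
Definition some_trajectory (pi : policy R S A) (mu : dist R (S * A)%type) :
  trajectory M pi mu := inhabited_witness (trajectory_exists pi mu).

Definition discounted_return (pi : policy R S A) (mu : dist R (S * A)%type)
    (X : trajectory M pi mu) (r : reward R S A) (o : omega X) : R :=
  limn (series (fun i : nat =>
    gamma M ^+ i * r (state X i o) (act X i o) (state X i.+1 o))).

Arguments discounted_return [pi mu] X r o.

Definition expected_return (pi : policy R S A) (r : reward R S A)
    (mu : dist R (S * A)%type) : R :=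
  let X := some_trajectory pi mu in
  (1 - gamma M) * fine ('E_(prob X)[discounted_return X r])%E.

Definition value_init (pi : policy R S A) (r : reward R S A) : R :=
  expected_return pi r (joint (init M) pi).

(* Conditioning on S_0 = s, A_1 = a means starting the trajectory there, so
   that the value is defined whatever the probability of that event. *)
Definition qvalue (pi : policy R S A) (r : reward R S A) (s : S) (a : A) : R :=
  expected_return pi r (point_mass R (s, a)).

Definition value (pi : policy R S A) (r : reward R S A) (s : S) : R :=
  \sum_a pi s a * qvalue pi r s a.

Definition advantage (pi : policy R S A) (r : reward R S A)
    (s : S) (a : A) : R :=
  qvalue pi r s a - value pi r s.

(* An online learner over the actions maps the utility vectors observed so
   far, oldest first, to its next mixed action. *)
Definition learner := seq (A -> R) -> dist R A.

(* CFR runs one learner per state; in round t the learner at s chooses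
   pi^t(. | s) having observed q_s(., pi^u; r^u) for the rounds u < t. *)
Definition cfr_run (T : nat) (L : S -> learner) (r : 'I_T -> reward R S A)
    (pi : 'I_T -> policy R S A) : Prop :=
  forall t s a, pi t s a =
    L s [seq qvalue (pi u) (r u) s | u : 'I_T <- enum 'I_T & (u < t)%N] a.

End mdp_values.

(* Main.v *)
(* The gap D(s) = sum_t (v_s(pi'; r^t) - v_s(pi^t; r^t)) splits into the
   pi'-average of the cumulative advantages at s, which is at most C, and
   gamma times the mean of D after one step of pi'.  At a state maximizing D
   this gives max D <= C + gamma max D, and the gap in the initial value is a
   mean of D.  The Bellman equation behind the splitting is obtained from the
   trajectory laws: the marginals of the chain of state-action pairs give the
   expected truncated returns, and dominated convergence their limit. *)
Require Import Defs.
From mathcomp Require Import all_boot all_order all_algebra.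
From mathcomp Require Import all_classical all_reals all_analysis.
From mathcomp Require Import measurable_realfun.

Set Implicit Arguments.
Unset Strict Implicit.
Unset Printing Implicit Defensive.

Import Order.TTheory GRing.Theory Num.Theory.
Import numFieldNormedType.Exports.
Local Open Scope ring_scope.

(* [Defs.pmf_ge0] is qualified because MathComp-Analysis has its own
   [pmf_ge0], about random variables. *)
Lemma dist_mean_le (R : realType) (X : finType) (d : dist R X) (f : X -> R)
    (B : R) : (forall x, f x <= B) -> \sum_x d x * f x <= B.
Proof.
move=> fB; rewrite -[leRHS]mul1r -(pmf_sum1 d) mulr_suml.
by apply: ler_sum => x _; apply: ler_wpM2l; [exact: Defs.pmf_ge0 | exact: fB].
Qed.

Lemma dist_mean_norm_le (R : realType) (X : finType) (d : dist R X)
    (f : X -> R) (B : R) :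
  (forall x, `|f x| <= B) -> `|\sum_x d x * f x| <= B.
Proof.
move=> fB; rewrite (le_trans (ler_norm_sum _ _ _)) //.
under eq_bigr do rewrite normrM (ger0_norm (Defs.pmf_ge0 d _)).
exact: dist_mean_le.
Qed.

Lemma sum_joint (R : realType) (X Y : finType) (d : dist R X)
    (k : X -> dist R Y) (f : X * Y -> R) :
  \sum_z joint d k z * f z = \sum_x d x * \sum_y k x y * f (x, y).
Proof.
under [RHS]eq_bigr do rewrite mulr_sumr.
rewrite pair_bigA; apply: eq_bigr => -[x y] _ /=.
by rewrite /joint_pmf mulrA.
Qed.

Section trajectories.

(** * Laws of the chain of state-action pairs *)

Context (R : realType) (S A : finType) (M : mdp R S A) (pi : policy R S A).

Definition step_kernel (z : S * A) : dist R (S * A)%type :=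
  joint (trans M z.1 z.2) pi.

Definition kernel_op (f : S * A -> R) : S * A -> R :=
  fun z => \sum_y step_kernel z y * f y.

(** One transition acting on laws, adjoint to [kernel_op]. It takes bare weights rather than a
    [dist], so that [iter] needs no proofs. *)
Definition kernel_push (m : S * A -> R) : S * A -> R :=
  fun y => \sum_z m z * step_kernel z y.

Lemma sum_kernel_push m f :
  \sum_y kernel_push m y * f y = \sum_z m z * kernel_op f z.
Proof.
rewrite /kernel_push /kernel_op.
under eq_bigr do rewrite mulr_suml.
rewrite exchange_big; apply: eq_bigr => z _; rewrite mulr_sumr.
by apply: eq_bigr => y _; rewrite mulrA.
Qed.

(** Moves [n] transitions from the law to the observable, which makes an expectation at time [n]
    explicitly linear in the initial law. *)
Lemma sum_iter_kernel_push n m f :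
  \sum_y iter n kernel_push m y * f y = \sum_z m z * iter n kernel_op f z.
Proof. by elim: n f => //= n IHn f; rewrite sum_kernel_push IHn -iterSr. Qed.

Lemma iter_kernel_op_bounded n f B :
  (forall z, `|f z| <= B) -> forall z, `|iter n kernel_op f z| <= B.
Proof. by move=> fB; elim: n => //= n IHn z; exact: dist_mean_norm_le. Qed.

Section fixed_trajectory.
Context (mu : dist R (S * A)%type) (X : trajectory M pi mu).

Definition steps (j : nat) (o : omega X) : S * A := (state X j o, act X j o).

(** Induction on the starting time: summing over the pair at time [j] turns a path from [j.+1] into
    a path from [j] that is one step longer, hence [n] and [w] stay general. The extra factor is
    absorbed by [kernel_push]. *)
Lemma steps_law j n (w : nat -> S * A) :
  let E := [set o | forall i, (i <= n)%N -> steps (j + i) o = w i]%classic in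
  measurable E /\ prob X E = (iter j kernel_push mu (w 0%N) *
                              \prod_(i < n) step_kernel (w i) (w i.+1))%:E.
Proof.
elim: j n w => [|j IHj] n w E.
  have -> : E = [set o | forall i, (i <= n)%N ->
      state X i o = (w i).1 /\ act X i o = (w i).2]%classic.
    apply/seteqP; split => o /= Eo i /Eo; rewrite /steps add0n.
      by move=> <-.
    by move=> [-> ->]; rewrite -surjective_pairing.
  split; first exact: trajectory_measurable.
  by rewrite trajectory_law -surjective_pairing.
pose cons_path z i := if i is i'.+1 then w i' else z.
pose F z := [set o | forall i, (i <= n.+1)%N ->
                       steps (j + i) o = cons_path z i]%classic.
have EF : E = (\bigcup_(z in [set: S * A]) F z)%classic.
  apply/seteqP; split => o /=.
    move=> Eo; exists (steps j o) => // -[|i] i_le; first by rewrite addn0.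
    by rewrite addnS -addSn Eo.
  by move=> [z _ Fo] i i_le; rewrite addSn -addnS Fo.
have mF z : measurable (F z) by have [] := IHj n.+1 (cons_path z).
have triv : trivIset [set: S * A] F.
  by move=> z y _ _ [u [Fz Fy]]; rewrite -[z](Fz 0%N isT) (Fy 0%N isT).
split.
  by rewrite EF; apply: fin_bigcup_measurable => //; exact: finite_finset.
rewrite EF measure_fin_bigcup //; last exact: finite_finset.
(* Indexing by an enumeration without repetition turns the finitely supported sum into a big
   operator. *)
have -> : [set: S * A]%classic = [set` index_enum (S * A)%type]%classic.
  by apply/seteqP; split => z // _; rewrite /= mem_index_enum.
rewrite -fsbig_seq ?index_enum_uniq //= /kernel_push mulr_suml -sumEFin.
apply: eq_bigr => z _; have [_ ->] := IHj n.+1 (cons_path z).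
by rewrite big_ord_recl mulrA.
Qed.

(** A reward involves two successive pairs, so it takes finitely many values and is a finite
    combination of indicators, whose probabilities come from [steps_law] with [n = 1]. *)
Lemma expectation_steps j (h : S * A -> S * A -> R) :
  let H o := h (steps j o) (steps j.+1 o) in
  (prob X).-integrable setT (EFin \o H) /\
  (\int[prob X]_o (H o)%:E)%E =
    (\sum_z iter j kernel_push mu z * \sum_y step_kernel z y * h z y)%:E.
Proof.
move=> H.
pose E (zy : (S * A) * (S * A)) :=
  [set o | steps j o = zy.1 /\ steps j.+1 o = zy.2]%classic.
have EP zy : measurable (E zy) /\ prob X (E zy) =
    (iter j kernel_push mu zy.1 * step_kernel zy.1 zy.2)%:E.
  have := steps_law j 1 (fun i => if i is 0%N then zy.1 else zy.2).
  rewrite big_ord1 /=; set F := mkset _; suff -> : F = E zy by [].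
  apply/seteqP; split => o /=.
    by move=> Fo; split; [have := Fo 0%N isT; rewrite addn0 |
                          have := Fo 1%N isT; rewrite addn1].
  by move=> [? ?] [|[|//]] _; rewrite ?addn0 ?addn1.
have HE o : (H o)%:E = (\sum_zy (h zy.1 zy.2)%:E * (\1_(E zy) o)%:E)%E.
  rewrite (bigD1 (steps j o, steps j.+1 o)) //= big1 ?adde0.
    by rewrite indicE mem_set // mule1.
  move=> zy zy_neq; rewrite indicE memNset ?mule0 //= => -[E1 E2].
  by move: zy_neq; rewrite E1 E2 -surjective_pairing eqxx.
have intE zy : (prob X).-integrable setT
    (fun o => (h zy.1 zy.2)%:E * (\1_(E zy) o)%:E)%E.
  by apply: integrableZl => //; apply: integrable_indic; exact: (EP zy).1.
have -> : EFin \o H = (fun o => \sum_zy (h zy.1 zy.2)%:E * (\1_(E zy) o)%:E)%E.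
  by apply/funext => o; rewrite -HE.
split; first exact: integrable_sum.
under eq_integral do rewrite HE.
rewrite integral_sum //.
transitivity (\sum_zy (h zy.1 zy.2 *
    (iter j kernel_push mu zy.1 * step_kernel zy.1 zy.2))%:E)%E.
  apply: eq_bigr => zy _; have [mE PE] := EP zy.
  rewrite integralZl //; last exact: integrable_indic.
  by rewrite integral_indic // setIT [X in (_ * X)%E]PE.
rewrite sumEFin; congr (_%:E).
rewrite -(pair_bigA _ (fun z y =>
  h z y * (iter j kernel_push mu z * step_kernel z y))) /=.
apply: eq_bigr => z _; rewrite mulr_sumr; apply: eq_bigr => y _.
by rewrite mulrC mulrA.
Qed.

End fixed_trajectory.

(** * Expected returns and Bellman equations for bounded rewards *)

Context (r : reward R S A) (U : R).
Context (r_bounded : forall s a s', `|r s a s'| <= U).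

Definition mean_reward (z : S * A) : R :=
  \sum_s trans M z.1 z.2 s * r z.1 z.2 s.

Lemma mean_rewardE z :
  mean_reward z = \sum_y step_kernel z y * r z.1 z.2 y.1.
Proof.
rewrite sum_joint; apply: eq_bigr => s _.
by rewrite /= -mulr_suml pmf_sum1 mul1r.
Qed.

Definition return_term (z : S * A) (i : nat) : R :=
  gamma M ^+ i * iter i kernel_op mean_reward z.

Definition return_from (z : S * A) : R := limn (series (return_term z)).

(** Comparison with a geometric series. It serves both the returns along one trajectory and the
    expected terms; the bound uniform in [n] later provides the dominating constant. *)
Lemma cvg_discounted_series (u : nat -> R) :
  (forall i, `|u i| <= U) ->
  (cvgn (series (fun i => gamma M ^+ i * u i)%R) /\
   forall n, `|series (fun i => gamma M ^+ i * u i) n| <= U / (1 - gamma M)).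
Proof.
move=> uU.
have g_ge0 := gamma_ge0 M; have g_lt1 := gamma_lt1 M.
have U_ge0 : 0 <= U := le_trans (normr_ge0 _) (uU 0%N).
have gn1 : `|gamma M| < 1 by rewrite ger0_norm.
have term_le i : `|gamma M ^+ i * u i| <= geometric U (gamma M) i.
  by rewrite normrM ger0_norm ?exprn_ge0 //= mulrC ler_wpM2r // exprn_ge0.
split.
  apply: normed_cvg.
  apply: (@series_le_cvg _ _ (geometric U (gamma M))) => //=.
  - by move=> n; rewrite mulr_ge0 // exprn_ge0.
  - exact: is_cvg_geometric_series.
move=> n; rewrite /series /=; apply: (le_trans (ler_norm_sum _ _ _)).
apply: (@le_trans _ _ (series (geometric U (gamma M)) n)).
  by apply: ler_sum => i _; exact: term_le.
rewrite geometric_seriesE ?lt_eqF //=.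
rewrite ler_wpM2r ?invr_ge0 ?subr_ge0 ?(ltW g_lt1) //.
by rewrite ler_piMr // gerBl exprn_ge0.
Qed.

Lemma mean_reward_bounded z : `|mean_reward z| <= U.
Proof. exact: dist_mean_norm_le. Qed.

Lemma cvg_return_term z :
  (series (return_term z) n @[n --> \oo] --> return_from z)%classic.
Proof.
have [cv _] := cvg_discounted_series
  (fun i => iter_kernel_op_bounded i mean_reward_bounded z).
exact: cv.
Qed.

Lemma cvg_sum_return_term (d : S * A -> R) :
  ((\sum_z d z * series (return_term z) n) @[n --> \oo] -->
   \sum_z d z * return_from z)%classic.
Proof.
apply: cvg_big => [|z _]; first exact: add_continuous.
by apply: cvgMl_tmp; exact: cvg_return_term.
Qed.

(** Limit of the recursion that peels the first term off a partial sum and factors [gamma M] out of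
    the others. *)
Lemma return_from_bellman z :
  return_from z = mean_reward z + gamma M * kernel_op return_from z.
Proof.
have := @cvg_return_term z; rewrite -cvg_shiftS => cvS.
apply: (cvg_unique _ cvS) => //.
have -> : (fun n => series (return_term z) n.+1) = (fun n => mean_reward z +
    gamma M * \sum_y step_kernel z y * series (return_term y) n).
  apply/funext => n.
  rewrite /series /= big_nat_recl // {1}/return_term /= expr0 mul1r.
  congr (_ + _); rewrite mulr_sumr.
  under [RHS]eq_bigr do rewrite mulr_sumr mulr_sumr.
  rewrite exchange_big /=; apply: eq_bigr => i _.
  rewrite /return_term exprS -mulrA mulr_sumr mulr_sumr; apply: eq_bigr => y _.
  by congr (_ * _); rewrite mulrCA.
by apply: cvgD; [exact: cvg_cst | apply: cvgMl_tmp; exact: cvg_sum_return_term].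
Qed.

(** Eliminates the probability space: from here on only finite sums over [return_from] remain. *)
Lemma expected_returnE (mu : dist R (S * A)%type) :
  expected_return M pi r mu = (1 - gamma M) * \sum_z mu z * return_from z.
Proof.
rewrite /expected_return; set X := some_trajectory M pi mu.
congr (_ * _).
pose F i o := gamma M ^+ i *
  r (state X i o) (act X i o) (state X i.+1 o).
have [intF EF] : (forall i, (prob X).-integrable setT (EFin \o F i)) /\
    (forall i, (\int[prob X]_o (F i o)%:E)%E =
               (\sum_z mu z * return_term z i)%:E).
  pose h i (z y : S * A) := gamma M ^+ i * r z.1 z.2 y.1.
  split=> i; have [intF EF] := expectation_steps X i (h i); first exact: intF.
  rewrite [LHS]EF; congr (_%:E).
  transitivity (\sum_z iter i kernel_push mu z *
      (gamma M ^+ i * mean_reward z)).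
    apply: eq_bigr => z _; rewrite mean_rewardE; congr (_ * _).
    by rewrite mulr_sumr; apply: eq_bigr => y _; rewrite mulrCA.
  under eq_bigr do rewrite mulrCA.
  rewrite -mulr_sumr sum_iter_kernel_push mulr_sumr.
  by apply: eq_bigr => z _; rewrite mulrCA.
pose Fn n o := series (F ^~ o) n.
have cvgF o : cvgn (series (F ^~ o)) /\
    forall n, `|Fn n o| <= U / (1 - gamma M).
  exact: cvg_discounted_series.
have mFn n : measurable_fun setT (Fn n).
  apply: measurable_sum => i; apply/measurable_EFinP.
  exact: measurable_int (intF i).
have EFn n : (\int[prob X]_o (Fn n o)%:E)%E =
    (\sum_z mu z * series (return_term z) n)%:E.
  under eq_integral do rewrite -sumEFin.
  rewrite integral_sum //.
  under eq_bigr do rewrite EF.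
  rewrite sumEFin exchange_big /=; congr (_%:E).
  by apply: eq_bigr => z _; rewrite mulr_sumr.
pose ret o := limn (series (F ^~ o)).
have mret : measurable_fun setT ret.
  by apply: (measurable_fun_cvg mFn) => o _; exact: (cvgF o).1.
(* The dominating function is constant, hence integrable for a probability. *)
have [|||_ _ cvE] := @dominated_convergence _ _ _ (prob X) setT measurableT
  (fun n => EFin \o Fn n) (EFin \o ret) (EFin \o cst (U / (1 - gamma M)))
  (fun n => (measurable_EFinP _ _).2 (mFn n)) ((measurable_EFinP _ _).2 mret).
- by apply: aeW => o _; apply: cvg_EFin; [near=> n | exact: (cvgF o).1].
- exact: finite_measure_integrable_cst.
- by apply: aeW => o n _; rewrite lee_fin; exact: (cvgF o).2.
have cvE' : ((\int[prob X]_o (Fn n o)%:E)%E @[n --> \oo] -->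
    (\sum_z mu z * return_from z)%:E)%classic.
  under eq_cvg do rewrite EFn.
  by apply: cvg_EFin; [near=> n | exact: cvg_sum_return_term].
by rewrite unlock (cvg_unique _ cvE cvE').
Unshelve. all: by end_near. Qed.

Lemma qvalue_return_from s a :
  qvalue M pi r s a = (1 - gamma M) * return_from (s, a).
Proof.
rewrite /qvalue expected_returnE; congr (_ * _).
rewrite (bigD1 (s, a)) //= /point_mass_pmf eqxx mul1r big1 ?addr0 // => z.
by move=> /negPf ->; rewrite mul0r.
Qed.

Lemma value_initE :
  value_init M pi r = \sum_s init M s * value M pi r s.
Proof.
rewrite /value_init expected_returnE sum_joint mulr_sumr.
apply: eq_bigr => s _; rewrite mulrCA /value; congr (_ * _).
by rewrite mulr_sumr; apply: eq_bigr => a _; rewrite qvalue_return_from mulrCA.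
Qed.

(** Values are already normalized, so [1 - gamma M] multiplies the reward term only. *)
Lemma qvalue_bellman s a :
  qvalue M pi r s a = (1 - gamma M) * mean_reward (s, a) +
    gamma M * \sum_s' trans M s a s' * value M pi r s'.
Proof.
rewrite qvalue_return_from return_from_bellman mulrDr mulrCA.
congr (_ + _ * _); rewrite /kernel_op sum_joint mulr_sumr.
apply: eq_bigr => s' _; rewrite mulrCA /value; congr (_ * _).
by rewrite mulr_sumr; apply: eq_bigr => a' _; rewrite qvalue_return_from mulrCA.
Qed.

End trajectories.

(** * Maximum principle and the regret bound *)

Lemma subharmonic_bound (R : realType) (S : finType) (D : S -> R) (g C : R)
    (K : S -> dist R S) : 0 <= g -> g < 1 ->
  (forall s, D s <= C + g * \sum_s' K s s' * D s') ->
  forall s, D s <= C / (1 - g).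
Proof.
move=> g_ge0 g_lt1 Dle s.
(* The given [s] shows that [S] is inhabited, so a maximizer exists. *)
have [m _ m_max] := @arg_maxP _ R S s xpredT D isT.
apply: (le_trans (m_max s isT)).
rewrite ler_pdivlMr ?subr_gt0 // mulrBr mulr1 lerBlDr.
apply: (le_trans (Dle m)); rewrite lerD2l mulrC ler_wpM2r //.
by apply: dist_mean_le => s'; exact: m_max.
Qed.

Theorem theorem1 (R : realType) (S A : finType) (M : mdp R S A)
    (T : nat) (T_ge1 : (1 <= T)%N) (U : R) (r : 'I_T -> reward R S A)
    (r_bounded : forall t s a s', - U <= r t s a s' <= U)
    (L : S -> learner R A) (pi : 'I_T -> policy R S A)
    (pi_cfr : cfr_run M L r pi)
    (C : R)
    (regret_le : forall s a, \sum_(t < T) advantage M (pi t) (r t) s a <= C) :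
  forall pi' : policy R S A,
    \sum_(t < T) (value_init M pi' (r t) - value_init M (pi t) (r t))
      <= C / (1 - gamma M).
Proof.
move=> pi'.
have rU t s a s' : `|r t s a s'| <= U by rewrite ler_norml.
pose D s := \sum_t (value M pi' (r t) s - value M (pi t) (r t) s).
suff D_le : forall s, D s <= C / (1 - gamma M).
  under eq_bigr do rewrite !(value_initE _ _ (rU _)) -sumrB.
  rewrite exchange_big /=; under eq_bigr do under eq_bigr do rewrite -mulrBr.
  by under eq_bigr do rewrite -mulr_sumr; exact: dist_mean_le.
(* State transition kernel induced by [pi']. *)
pose mix s s' := \sum_a pi' s a * trans M s a s'.
have mix_ge0 s s' : 0 <= mix s s'.
  by apply: sumr_ge0 => a _; rewrite mulr_ge0 ?Defs.pmf_ge0.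
have mix_sum1 s : \sum_s' mix s s' = 1.
  rewrite exchange_big -(pmf_sum1 (pi' s)) /=; apply: eq_bigr => a _.
  by rewrite -mulr_sumr pmf_sum1 mulr1.
apply: (subharmonic_bound (K := fun s => Dist (mix_ge0 s) (mix_sum1 s))).
- exact: gamma_ge0.
- exact: gamma_lt1.
move=> s /=.
have -> : D s = \sum_a pi' s a * \sum_t advantage M (pi t) (r t) s a +
    gamma M * \sum_s' mix s s' * D s'.
  (* The value of [pi t] at [s] is constant in [a], so it may be averaged under [pi' s]; then
     [qvalue] of [pi t] is added and subtracted. *)
  transitivity (\sum_t \sum_a pi' s a * (advantage M (pi t) (r t) s a +
      (qvalue M pi' (r t) s a - qvalue M (pi t) (r t) s a))).
    apply: eq_bigr => t _; rewrite /advantage.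
    under eq_bigr do rewrite addrC subrKA mulrBr.
    by rewrite sumrB -mulr_suml pmf_sum1 mul1r.
  rewrite exchange_big /=; under eq_bigr do rewrite -mulr_sumr big_split mulrDr.
  rewrite big_split /=; congr (_ + _).
  have qvalue_gap a :
      \sum_t (qvalue M pi' (r t) s a - qvalue M (pi t) (r t) s a) =
      gamma M * \sum_s' trans M s a s' * D s'.
    rewrite /D; under [in RHS]eq_bigr do rewrite mulr_sumr.
    rewrite [in RHS]exchange_big mulr_sumr; apply: eq_bigr => t _ /=.
    (* The mean reward depends on no policy, so it cancels between the two Bellman equations. *)
    rewrite !(qvalue_bellman _ _ (rU t)) opprD addrACA subrr add0r.
    rewrite -mulrBr -sumrB.
    by congr (_ * _); apply: eq_bigr => s' _; rewrite mulrBr.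
  under eq_bigr do rewrite qvalue_gap mulrCA mulr_sumr.
  rewrite -mulr_sumr exchange_big /=; congr (_ * _); apply: eq_bigr => s' _.
  by rewrite mulr_suml; apply: eq_bigr => a _; rewrite mulrA.
by rewrite lerD2r; apply: dist_mean_le.
Qed.
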